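(* Let $G=(V,E)$ be a finite connected simple $d$-regular graph on $N$ vertices with chromatic number $\chi$ and largest normalized Laplacian eigenvalue $\lambda_N$. Fix a proper $\chi$-coloring with coloring classes $V_1,\dots,V_\chi$ such that for all $i$ and all $v\in V$, $e(v,V_i)=\deg v/(\chi-1)$ if $v\notin V_i$ and $e(v,V_i)=0$ if $v\in V_i$. Then \[\lambda_N\leq\max\Bigl\{\frac{N}{d}\cdot\frac{\chi-1}{\chi},\ \frac{\chi}{\chi-1}\Bigr\}.\]
   Context: The normalized Laplacian is $L=\mathrm{Id}-D^{-1}A$, with $A$ the adjacency matrix and $D$ the diagonal degree matrix. For $v\in V$ and $U\subseteq V$, $e(v,U)$ is the number of edges $\{v,u\}\in E$ with $u\in U$. *)

(* Defs.v *)
From HB Require Import structures.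
From mathcomp Require Import all_boot all_order all_algebra.

Set Implicit Arguments.
Unset Strict Implicit.
Unset Printing Implicit Defensive.

Import Order.TTheory GRing.Theory Num.Theory.

(* Finite simple graphs: edges are given by a symmetric, loopless adjacency
   relation, so the edges {v, u} at v correspond to the neighbours u of v. *)
Record sgraph := SGraph {
  vertex :> finType;
  adj : rel vertex;
  adj_sym : symmetric adj;
  adj_irr : irreflexive adj
}.

Definition edges_to (G : sgraph) (v : G) (U : {set G}) : nat :=
  #|[set u in U | adj v u]|.

Definition deg (G : sgraph) (v : G) : nat := #|[set u | adj v u]|.

Definition regular (G : sgraph) (d : nat) : Prop := forall v : G, deg v = d.

Definition connected (G : sgraph) : Prop :=
  (0 < #|G|)%N /\ forall x y : G, connect (@adj G) x y.

Definition proper_coloring (G : sgraph) (k : nat) (c : {ffun G -> 'I_k}) : bool :=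
  [forall x, forall y, adj x y ==> (c x != c y)].

Definition color_class (G : sgraph) (k : nat) (c : {ffun G -> 'I_k}) (i : 'I_k) :
  {set G} := [set v | c v == i].

Definition colorable (G : sgraph) (k : nat) : bool :=
  [exists c : {ffun G -> 'I_k}, proper_coloring c].

Lemma colorable_ex (G : sgraph) : exists k, colorable G k.
Proof.
exists #|G|; apply/existsP; exists [ffun v => enum_rank v].
apply/forallP => x; apply/forallP => y; apply/implyP => xy.
rewrite !ffunE (inj_eq enum_rank_inj).
by apply: contraL xy => /eqP ->; rewrite adj_irr.
Qed.

Definition chromatic_number (G : sgraph) : nat := ex_minn (colorable_ex G).

Local Open Scope ring_scope.

(* Matrices are indexed by 'I_#|G| through the enumeration of the vertices. *)
Definition adj_mx (R : rcfType) (G : sgraph) : 'M[R]_#|G| :=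
  \matrix_(i, j) (adj (enum_val i : G) (enum_val j))%:R.

Definition deg_mx (R : rcfType) (G : sgraph) : 'M[R]_#|G| :=
  diag_mx (\row_j (deg (enum_val j : G))%:R).

(* invmx is the inverse only when deg_mx is invertible, i.e. when the graph has
   no isolated vertex. *)
Definition normalized_laplacian (R : rcfType) (G : sgraph) : 'M[R]_#|G| :=
  1%:M - invmx (deg_mx R G) *m adj_mx R G.

(* The library's eigenvalue is in terms of row eigenvectors; a square matrix and
   its transpose have the same eigenvalues. *)
Definition largest_eigenvalue (R : rcfType) (n : nat) (M : 'M[R]_n) (a : R) : Prop :=
  eigenvalue M a /\ forall b : R, eigenvalue M b -> b <= a.

(* Main.v *)
(* For a sum-zero-on-every-class eigenvector of the adjacency matrix with
   eigenvalue mu, subtracting the edges of G from the complete multipartite graph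
   on the classes gives a graph of degree N - N/chi - d for which the same vector
   has eigenvalue -mu; hence -mu <= N - N/chi - d.  Summing the eigenvector
   equation over a class shows that any eigenvector of G that does not sum to
   zero on every class belongs to mu = d or mu = -d/(chi - 1), that is, to the
   Laplacian eigenvalues 0 and chi/(chi - 1). *)
Require Import Defs.
From HB Require Import structures.
From mathcomp Require Import all_boot all_order all_algebra ring lra.

Set Implicit Arguments.
Unset Strict Implicit.
Unset Printing Implicit Defensive.

Import Order.TTheory GRing.Theory Num.Theory.
Local Open Scope ring_scope.

Lemma natr_deg (R : pzSemiRingType) (G : sgraph) (v : G) :
  (deg v)%:R = \sum_u (adj u v)%:R :> R.
Proof.
rewrite -natr_sum /deg -sum1_card big_mkcond /=; congr _%:R.
by apply: eq_bigr => u _; rewrite inE adj_sym; case: adj.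
Qed.

Lemma natr_edges_to (R : pzSemiRingType) (G : sgraph) (v : G) (U : {set G}) :
  (edges_to v U)%:R = \sum_(u in U) (adj v u)%:R :> R.
Proof.
rewrite -natr_sum /edges_to -sum1_card big_mkcond [in RHS]big_mkcond /=.
by congr _%:R; apply: eq_bigr => u _; rewrite inE; case: (u \in U); case: adj.
Qed.

(** Regularity makes the degree matrix the scalar [d], so the Laplacian is [1 - A / d] and its row
    eigenvectors for [a] are those of [A] for [d * (1 - a)]. *)
Lemma eigenvalue_regular_laplacian (R : rcfType) (G : sgraph) (d : nat) (a : R) :
  (0 < d)%N -> regular G d -> eigenvalue (normalized_laplacian R G) a ->
  exists2 f : G -> R, exists v, f v != 0 &
    forall v, \sum_u f u * (adj u v)%:R = d%:R * (1 - a) * f v.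
Proof.
move=> d_gt0 reg /eigenvalueP[x xL x_neq0].
have d_neq0 : d%:R != 0 :> R by rewrite pnatr_eq0 -lt0n.
have degE : deg_mx R G = d%:R%:M.
  by apply/matrixP => i j; rewrite !mxE reg.
have xA : x *m adj_mx R G = (d%:R * (1 - a)) *: x.
  move: xL; rewrite /normalized_laplacian degE invmx_scalar mul_scalar_mx.
  rewrite mulmxBr mulmx1 -scalemxAr => xL.
  have -> : x *m adj_mx R G = d%:R *: (x - (x - d%:R^-1 *: (x *m adj_mx R G))).
    by rewrite opprB addrC subrK scalerA divff // scale1r.
  by rewrite xL -{1}[x]scale1r -scalerBl scalerA.
exists (fun u => x 0 (enum_rank u)) => [|v].
  by case/rV0Pn: x_neq0 => i xi; exists (enum_val i); rewrite enum_valK.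
have := congr1 (fun M : 'rV_#|G| => M 0 (enum_rank v)) xA.
rewrite !mxE => <-; rewrite (reindex (@enum_val G G)) /=; last first.
  by exists enum_rank => y _; rewrite ?enum_valK ?enum_rankK.
by apply: eq_bigr => i _; rewrite !mxE enum_valK enum_rankK.
Qed.

Section BalancedColoring.

Variables (R : realFieldType) (G : sgraph) (d k : nat).
Hypothesis reg : regular G d.
Variable (c : {ffun G -> 'I_k}).
Hypothesis proper : proper_coloring c.
Variable (r : R).
Hypothesis balanced : forall i v,
  v \notin color_class c i -> (edges_to v (color_class c i))%:R = r.

Lemma adj_color_neq (u v : G) : adj u v -> c u != c v.
Proof.
by move=> uv; move/forallP/(_ u)/forallP/(_ v)/implyP: proper; apply.
Qed.

Lemma natr_edges_to_color_class i v :
  \sum_(u | c u == i) (adj v u)%:R = if c v == i then 0 else r.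
Proof.
case: ifP => [/eqP cv|cv].
  rewrite big1 // => u /eqP cu; case: (boolP (adj v u)) => // /adj_color_neq.
  by rewrite cu cv eqxx.
rewrite -(@balanced i v) ?natr_edges_to ?inE ?cv //.
by apply: eq_bigl => u; rewrite inE.
Qed.

(** Summing the equation over class [i] and exchanging the sums counts [f u] once per edge from [u]
    into the class: [r] times off the class, never on it. *)
Lemma eigenvector_class_sum (f : G -> R) (mu : R) i :
  (forall v, \sum_u f u * (adj u v)%:R = mu * f v) ->
  mu * \sum_(v | c v == i) f v
    = r * (\sum_v f v - \sum_(v | c v == i) f v).
Proof.
move=> ev; rewrite mulr_sumr -(eq_bigr _ (fun v _ => ev v)) exchange_big /=.
rewrite (bigID (fun u => c u == i) predT f) /= [_ + _ - _]addrC addKr mulr_sumr.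
rewrite [RHS]big_mkcond /=; apply: eq_bigr => u _.
rewrite -mulr_sumr natr_edges_to_color_class; case: eqP => _ /=.
  by rewrite mulr0.
exact: mulrC.
Qed.

Lemma sum_color_classes (f : G -> R) :
  \sum_i \sum_(v | c v == i) f v = \sum_v f v.
Proof. by rewrite (partition_big c xpredT). Qed.

Hypothesis (d_gt0 : (0 < d)%N) (r_def : r * (k%:R - 1) = d%:R).

Lemma balanced_neq0 : r != 0.
Proof.
apply: contraTneq d_gt0 => r0; move: r_def; rewrite r0 mul0r => /esym/eqP.
by rewrite pnatr_eq0 => /eqP ->.
Qed.

(** The constant vector 1 has eigenvalue [d = r * (k - 1)], so its class sums satisfy
    [r * (k - 1) * s = r * (#|G| - s)]; cancelling [r] shows that all classes have size
    [#|G| / k]. *)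
Lemma card_balanced_class i :
  k%:R * (\sum_(v | c v == i) 1) = #|G|%:R :> R.
Proof.
have ev (v : G) : \sum_u 1 * (adj u v)%:R = d%:R * 1 :> R.
  rewrite mulr1 -(reg v) natr_deg.
  by under eq_bigr do rewrite mul1r.
have := eigenvector_class_sum i ev.
rewrite [\sum_v 1]sumr_const -r_def => sizeE.
apply: (mulfI balanced_neq0); rewrite -[k%:R](subrK 1).
by rewrite mulrDl mulrDr mulrA sizeE; ring.
Qed.

Lemma eigenvector_sum0 (f : G -> R) (mu : R) i :
  (forall v, \sum_u f u * (adj u v)%:R = mu * f v) ->
  mu != d%:R -> mu != - r -> \sum_(v | c v == i) f v = 0.
Proof.
move=> ev mu_d mu_r.
(* Adding the class identities over all [i] gives [mu * S = r * (k - 1) * S = d * S] for the total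
   [S]. *)
have total0 : \sum_v f v = 0.
  have tot : mu * \sum_v f v = d%:R * \sum_v f v.
    rewrite -{1}sum_color_classes mulr_sumr.
    under eq_bigr do rewrite eigenvector_class_sum //.
    rewrite -mulr_sumr sumrB sumr_const card_ord sum_color_classes -r_def.
    by rewrite -mulr_natl; ring.
  apply/eqP; move/eqP: tot; rewrite -subr_eq0 -mulrBl mulf_eq0 subr_eq0.
  by rewrite (negPf mu_d).
(* With zero total, the class identity reads [(mu + r) * s = 0]. *)
have /eqP := eigenvector_class_sum i ev.
rewrite total0 sub0r mulrN -addr_eq0 -mulrDl mulf_eq0 addr_eq0 (negPf mu_r) /=.
by move/eqP.
Qed.

Lemma balanced_eigenvalue_lbound (f : G -> R) (mu : R) (w : G) :
  f w != 0 -> (forall v, \sum_u f u * (adj u v)%:R = mu * f v) ->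
  (forall i, \sum_(v | c v == i) f v = 0) ->
  - mu <= #|G|%:R * ((k%:R - 1) / k%:R) - d%:R.
Proof.
move=> fw ev class0.
have k_neq0 : k%:R != 0 :> R.
  by rewrite pnatr_eq0 -lt0n (leq_ltn_trans (leq0n (c w))).
(* The eigenvector equation is read at a vertex where [|f|] is largest. *)
have [v _ fmax] := @arg_maxP _ _ _ w xpredT (fun u => `|f u|) isT.
have fv_gt0 : 0 < `|f v| by rewrite (lt_le_trans _ (fmax w isT)) // normr_gt0.
(* the adjacency of the complement of G in the complete multipartite graph *)
pose cadj u : R := (c u != c v)%:R - (adj u v)%:R.
(* Properness enters here: every edge of [G] joins distinct classes. *)
have cadj_ge0 u : 0 <= cadj u.
  rewrite /cadj; case: (boolP (adj u v)) => [/adj_color_neq ->|_].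
    by rewrite subrr.
  by rewrite subr0 ler0n.
have offclass (g : G -> R) :
    \sum_u g u * (c u != c v)%:R = \sum_u g u - \sum_(u | c u == c v) g u.
  rewrite [in RHS](bigID (fun u => c u == c v)) /= [_ + _ - _]addrC addKr.
  rewrite [RHS]big_mkcond; apply: eq_bigr => u _.
  by case: ifP; rewrite ?mulr1 ?mulr0.
have cadj_f : \sum_u f u * cadj u = - mu * f v.
  under eq_bigr do rewrite mulrBr.
  rewrite sumrB offclass ev class0 -sum_color_classes big1 //.
  by rewrite subr0 sub0r mulNr.
have cadj_sum : \sum_u cadj u = #|G|%:R * ((k%:R - 1) / k%:R) - d%:R.
  rewrite sumrB -natr_deg reg; congr (_ - _).
  under eq_bigr do rewrite -[_%:R]mul1r.
  rewrite offclass [\sum_u 1]sumr_const -(card_balanced_class (c v)).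
  by field.
(* By the triangle inequality, [|mu * f v|] is at most the sum of [cadj u * |f u|], hence at most
   [|f v|] times the sum of the nonnegative weights [cadj u]. *)
rewrite -(ler_pM2r fv_gt0) -cadj_sum.
apply: (le_trans (y := `|- mu * f v|)).
  by rewrite normrM ler_pM2r // ler_norm.
rewrite -cadj_f mulr_suml; apply: (le_trans (ler_norm_sum _ _ _)).
apply: ler_sum => u _; rewrite normrM (ger0_norm (cadj_ge0 u)) mulrC.
by rewrite ler_wpM2l //; apply: fmax.
Qed.

End BalancedColoring.

Theorem theorem6p3 (R : rcfType) (G : sgraph) (d : nat)
    (hd : (0 < d)%N) (hconn : connected G) (hreg : regular G d)
    (lambdaN : R)
    (hlambda : largest_eigenvalue (normalized_laplacian R G) lambdaN)
    (c : {ffun G -> 'I_(chromatic_number G)}) (hc : proper_coloring c)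
    (he : forall (i : 'I_(chromatic_number G)) (v : G),
        (v \notin color_class c i ->
           (edges_to v (color_class c i))%:R
             = (deg v)%:R / ((chromatic_number G)%:R - 1) :> R) /\
        (v \in color_class c i -> edges_to v (color_class c i) = 0%N)) :
  lambdaN <= Num.max
    (#|G|%:R / d%:R *
       (((chromatic_number G)%:R - 1) / (chromatic_number G)%:R))
    ((chromatic_number G)%:R / ((chromatic_number G)%:R - 1)).
Proof.
move: (chromatic_number G) c hc he => k c hc he.
have d_gt0 : 0 < d%:R :> R by rewrite ltr0n.
have [f [w fw] ev] := eigenvalue_regular_laplacian hd hreg hlambda.1.
(* As [d > 0], [w] has a neighbour, which has another colour. *)
have k_gt1 : 1 < k%:R :> R.
  have: (0 < #|[set u | adj w u]|)%N by rewrite -/(deg w) hreg.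
  case/card_gt0P => u; rewrite inE => /(adj_color_neq hc) wu.
  by have := max_card [set c w; c u]; rewrite cards2 wu card_ord ltr1n.
have k1_gt0 : 0 < k%:R - 1 :> R by rewrite subr_gt0.
pose r : R := d%:R / (k%:R - 1).
have r_def : r * (k%:R - 1) = d%:R by rewrite divfK // gt_eqF.
have balanced i v : v \notin color_class c i ->
    (edges_to v (color_class c i))%:R = r.
  by move=> vi; rewrite (he i v).1 // hreg.
rewrite le_max orbC.
(* Beyond [k / (k - 1)], [lambdaN] differs from 0 and from [k / (k - 1)], the values at which [mu]
   is [d] or [- r]. *)
have [//|/= lambda_gt] := leP lambdaN.
have lambda_gt0 : 0 < lambdaN.
  by rewrite (le_lt_trans _ lambda_gt) // divr_ge0 ?ler0n // ltW.
have mu_d : d%:R * (1 - lambdaN) != d%:R.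
  by rewrite lt_eqF // gtr_pMr // ltrBlDr ltrDl.
have mu_r : d%:R * (1 - lambdaN) != - r.
  rewrite lt_eqF // /r -mulrN ltr_pM2l // ltrBlDr -ltrBlDl opprK.
  rewrite (_ : 1 + _ = k%:R / (k%:R - 1)) //.
  by field; rewrite gt_eqF.
have := balanced_eigenvalue_lbound hreg hc balanced hd r_def fw ev
  (fun i => eigenvector_sum0 hc balanced r_def i ev mu_d mu_r).
(* With [mu = d * (1 - lambdaN)], the term [- d] cancels on both sides of the bound. *)
rewrite mulrAC ler_pdivlMr // => bound; lra.
Qed.
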